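(* There exists an absolute constant $c>0$ such that for every finite connected graph $G=(V,E)$ with $n=|V|\ge2$ and every choice of positive edge rates $(r_e:e\in E)$, $$\min_{k\in\{1,\dots,n-1\}}t_{\mathrm{mix}}^{\mathrm{EX}(k)}\ge c\,t_{\mathrm{mix}}^{\mathrm{RW}(1)}.$$
   Context: Each edge $e$ rings at the times of an independent rate-$r_e$ Poisson process. $\mathrm{EX}(k)$ (symmetric exclusion process with $k$ particles): continuous-time Markov chain on $k$-subsets of $V$ (occupied sites); when $e$ rings, the contents (occupied/vacant) of the endpoints of $e$ are swapped; its stationary law is uniform on $\binom Vk$. $\mathrm{RW}(1)$: continuous-time random walk on $V$ jumping across each incident edge $e$ at rate $r_e$; its stationary law is uniform on $V$. For such a process $Q$, $t_{\mathrm{mix}}^{Q}$ is the least $t$ such that, from every initial state, the law at time $t$ is within total variation distance $1/4$ of the stationary law. *)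

(* Defs.v *)
From mathcomp Require Import all_boot all_order all_algebra.
From mathcomp Require Import all_classical all_reals all_analysis.
Set Implicit Arguments.
Unset Strict Implicit.
Unset Printing Implicit Defensive.
Import Order.TTheory GRing.Theory Num.Theory.
Import numFieldNormedType.Exports.
Local Open Scope ring_scope.
Local Open Scope classical_set_scope.

(* A finite simple graph on V is a set E of two-element subsets of V; the
   edge rates are r : {set V} -> R, of which only the values on E matter. *)
Definition simple_edges (V : finType) (E : {set {set V}}) : Prop :=
  forall e, e \in E -> #|e| = 2%N.

Definition connected_graph (V : finType) (E : {set {set V}}) : Prop :=
  forall x y : V, connect (fun u v => [set u; v]%SET \in E) x y.

(* For e = {x, y}, the transposition of x and y. *)
Definition across (V : finType) (e : {set V}) (v : V) : V :=
  if v \in e then odflt v [pick w in (e :\ v)%SET] else v.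

Definition swap_contents (V : finType) (e A : {set V}) : {set V} :=
  [set across e v | v in A]%SET.

Section MarkovChain.
Variables (R : realType) (S : finType).

(* Generator of the chain that jumps from x to y at rate q x y for x != y;
   the values q x x are ignored. *)
Definition generator (q : S -> S -> R) (x y : S) : R :=
  if x == y then - \sum_(z | z != x) q x z else q x y.

Definition generator_mx (q : S -> S -> R) : 'M[R]_#|S| :=
  \matrix_(i, j) generator q (enum_val i) (enum_val j).

(* Law at time t started from x: row x of exp (t L), with L the generator. *)
Definition law (q : S -> S -> R) (t : R) (x y : S) : R :=
  limn (series (fun m : nat =>
    ((t *: generator_mx q) ^+ m) (enum_rank x) (enum_rank y) / m`!%:R)).

Definition tv_dist (mu nu : S -> R) : R :=
  \big[Num.max/0]_(A : {set S}) `|\sum_(x in A) mu x - \sum_(x in A) nu x|.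

Definition uniform_law (_ : S) : R := #|S|%:R^-1.

(* Mixing time at level 1/4 of a chain whose stationary law is uniform; it
   would be +oo if the chain did not mix. *)
Definition tmix (q : S -> S -> R) : \bar R :=
  ereal_inf [set t%:E | t in [set t : R | 0 <= t /\
    forall x, tv_dist (law q t x) uniform_law <= 4%:R^-1]].

End MarkovChain.

Definition ksubset (V : finType) (k : nat) : finType :=
  {A : {set V} | #|A| == k}.

Definition EX (R : realType) (V : finType) (E : {set {set V}})
    (r : {set V} -> R) (k : nat) (A B : ksubset V k) : R :=
  \sum_(e in E | swap_contents e (val A) == val B) r e.

Definition RW1 (R : realType) (V : finType) (E : {set {set V}})
    (r : {set V} -> R) (x y : V) : R :=
  \sum_(e in E | (x \in e) && (across e x == y)) r e.

(* Main.v *)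
Require Import Defs.
From mathcomp Require Import all_boot all_order all_algebra.
From mathcomp Require Import all_classical all_reals all_analysis.
From mathcomp Require Import perm ring lra zify.
Set Implicit Arguments.
Unset Strict Implicit.
Unset Printing Implicit Defensive.
Import Order.TTheory GRing.Theory Num.Theory.
Import numFieldNormedType.Exports.
Local Open Scope ring_scope.

(** The constant is c = 1/14: if the exclusion process EX(k) is within total
    variation 1/4 of uniform at time t from every start, then so is the random
    walk at time 14 t.

    Amplification.  Mixing at level 1/4 halves the oscillation of every
    observable over a time t ([evolve_osc_half]), so at time s = 7 t the
    oscillation of an observable of EX(k) has shrunk by 2^7 = 128.

    Duality.  A single particle of the exclusion process moves as the random
    walk, so the expected number of particles in B at time s, started from A, is
    the sum over a in A of p(a, B), where p is the walk kernel at time s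
    ([evolve_count]).  The number of particles in B varies by at most
    min(k, n - k, |B|), hence the sum of p(a, B) over a set A of size k is within
    min(k, n - k, |B|) / 128 of its average k |B| / n.  Taking complements gives
    the same for |A| = n - k, so one may use sets of size
    j = min(k, n - k) <= n / 2.

    From j-sets to single points.  Suppose first 16 j <= n.  If p^2(x, B) exceeds
    |B| / n + 1/4, then p(x, .) puts mass more than 1/8 on the set H of sites z
    with p(z, B) >= |B| / n + 1/8.  If H has at most j points it lies in a j-set,
    which by the case B = {x} and symmetry has p(x, .)-mass at most
    j / n + 1/128 < 1/8; otherwise H contains a j-set on which p(., B) is
    uniformly too large.  Both are impossible ([hit2_sparse]).  Suppose next
    16 j > n.  The case B = {x} bounds |p(x, A) - j / n| for every j-set A, and
    averaging over the j-subsets of a large set (or of its complement) loses only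
    a factor n / j < 16 ([hit_dense]).

    The time-t law is the exponential of a matrix; the exponential is developed
    just far enough to give the semigroup property, positivity, and
    compatibility with intertwining matrices, from which conservation of mass and
    duality both follow. *)

(** * The matrix exponential *)

Lemma big_triangle (M : nmodType) (N : nat) (F : nat -> nat -> M) :
  \sum_(m < N) \sum_(i < m.+1) F (m - i)%N i =
  \sum_(i < N) \sum_(j < N | (j + i < N)%N) F j i.
Proof.
under eq_bigr => m _ do
  rewrite (big_ord_widen_cond N xpredT (fun i => F (m - i)%N i)) //.
rewrite (exchange_big_dep xpredT) //=; apply: eq_bigr => i _.
transitivity (\sum_(i <= m < N) F (m - i)%N i).
  by rewrite big_geq_mkord; apply: eq_bigl => m.
have := big_addn 0 N i xpredT (fun m => F (m - i)%N i).
rewrite add0n => ->; rewrite big_mkord.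
transitivity (\sum_(j < N - i) F j i).
  by apply: eq_bigr => j _; rewrite addnK.
rewrite (big_ord_widen_cond N xpredT (fun j => F j i)) ?leq_subr //.
by apply: eq_bigl => j; rewrite /= ltn_subRL addnC.
Qed.

Section MatrixExponential.
Local Open Scope classical_set_scope.
Variable R : realType.

Lemma cvg_sum_ord n (u : 'I_n -> R^nat) (l : 'I_n -> R) :
  (forall i, u i m @[m --> \oo] --> l i) ->
  \sum_i u i m @[m --> \oo] --> \sum_i l i.
Proof. by move=> ul; apply: cvg_big => //; exact: add_continuous. Qed.

(** Bounds the operator norm for the sup norm; unlike a bound on the entries it is
    submultiplicative. *)
Definition row_bound n (A : 'M[R]_n) (a : R) :=
  forall i, \sum_j `|A i j| <= a.

Lemma row_bound_entry n (A : 'M[R]_n) a i j : row_bound A a -> `|A i j| <= a.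
Proof.
by move=> /(_ i); apply: le_trans; rewrite (bigD1 j) //= lerDl sumr_ge0.
Qed.

Lemma row_bound1 n : row_bound (1 : 'M[R]_n) 1.
Proof.
move=> i; rewrite (bigD1 i) //= big1 ?addr0.
  by rewrite mxE eqxx normr1.
by move=> j /negPf ji; rewrite mxE eq_sym ji normr0.
Qed.

Lemma row_boundM n (A B : 'M[R]_n) a b :
  row_bound A a -> row_bound B b -> row_bound (A * B) (a * b).
Proof.
move=> Aa Bb i.
have b0 : 0 <= b by apply: le_trans (Bb i); exact: sumr_ge0.
apply: (@le_trans _ _ (\sum_j \sum_k `|A i k| * `|B k j|)).
  apply: ler_sum => j _; rewrite mxE; apply: le_trans (ler_norm_sum _ _ _) _.
  by apply: ler_sum => k _; rewrite normrM.
rewrite exchange_big /=; apply: (@le_trans _ _ (\sum_k `|A i k| * b)).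
  by apply: ler_sum => k _; rewrite -mulr_sumr ler_wpM2l.
by rewrite -mulr_suml ler_wpM2r.
Qed.

Lemma row_boundX n (A : 'M[R]_n) a m : row_bound A a -> row_bound (A ^+ m) (a ^+ m).
Proof.
move=> Aa; elim: m => [|m IH]; first exact: row_bound1.
by rewrite !exprS; exact: row_boundM.
Qed.

Definition entry_sum n (A : 'M[R]_n) : R := \sum_i \sum_j `|A i j|.

Lemma entry_sum_ge0 n (A : 'M[R]_n) : 0 <= entry_sum A.
Proof. by apply: sumr_ge0 => i _; exact: sumr_ge0. Qed.

Lemma row_bound_entry_sum n (A : 'M[R]_n) : row_bound A (entry_sum A).
Proof.
by move=> i; rewrite /entry_sum [leRHS](bigD1 i) //= lerDl; apply: sumr_ge0 => k _;
  exact: sumr_ge0.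
Qed.

Definition expmx n (A : 'M[R]_n) : 'M[R]_n :=
  \matrix_(i, j) limn (series (fun m => (A ^+ m) i j / m`!%:R)).

Definition expmx_trunc n (A : 'M[R]_n) (N : nat) : 'M[R]_n :=
  \sum_(m < N) m`!%:R^-1 *: A ^+ m.

Lemma expmx_truncE n (A : 'M[R]_n) N i j :
  expmx_trunc A N i j = series (fun m => (A ^+ m) i j / m`!%:R) N.
Proof.
rewrite /series /= big_mkord summxE; apply: eq_bigr => m _.
by rewrite mxE mulrC.
Qed.

Lemma expmx_cvg n (A : 'M[R]_n) i j :
  expmx_trunc A N i j @[N --> \oo] --> expmx A i j.
Proof.
rewrite mxE; under eq_fun do rewrite expmx_truncE.
have Aa := row_bound_entry_sum A.
apply: normed_cvg; apply: (series_le_cvg _ _ _ (is_cvg_series_exp_coeff (entry_sum A))).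
- by move=> m /=.
- by move=> m; rewrite /exp_coeff /= divr_ge0 // exprn_ge0 // entry_sum_ge0.
- move=> m /=; rewrite /exp_coeff /= normrM normfV normr_nat ler_wpM2r //.
  exact: row_bound_entry (row_boundX m Aa).
Qed.

Lemma expmx_unique n (A B : 'M[R]_n) :
  (forall i j, expmx_trunc A N i j @[N --> \oo] --> B i j) -> expmx A = B.
Proof.
move=> AB; apply/matrixP => i j.
exact: (cvg_unique _ (@expmx_cvg n A i j) (AB i j)).
Qed.

Lemma expmx_truncM n (A B : 'M[R]_n) N :
  expmx_trunc A N * expmx_trunc B N =
  \sum_(i < N) \sum_(j < N) (j`!%:R^-1 * i`!%:R^-1) *: (A ^+ j * B ^+ i).
Proof.
rewrite /expmx_trunc mulr_sumr; apply: eq_bigr => i _.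
rewrite mulr_suml; apply: eq_bigr => j _.
by rewrite -[LHS]/((_ *: _) *m (_ *: _)) -scalemxAl -scalemxAr scalerA.
Qed.

Lemma expmx_truncD n (A B : 'M[R]_n) N : A * B = B * A ->
  expmx_trunc (A + B) N =
  \sum_(i < N) \sum_(j < N | (j + i < N)%N)
    (j`!%:R^-1 * i`!%:R^-1) *: (A ^+ j * B ^+ i).
Proof.
move=> AB; rewrite -(@big_triangle _ N
  (fun j i => (j`!%:R^-1 * i`!%:R^-1) *: (A ^+ j * B ^+ i))).
apply: eq_bigr => m _; rewrite exprDn_comm // scaler_sumr; apply: eq_bigr => i _.
rewrite -scalerMnr scalerMnl; congr (_ *: _).
have im : (i <= m)%N by rewrite -ltnS.
rewrite -mulr_natr -(bin_fact im) !natrM; field.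
by rewrite !pnatr_eq0 -!lt0n bin_gt0 !fact_gt0 im.
Qed.

(** The terms of the Cauchy product that the truncation of the exponential of
    [A + B] misses: those of total degree at least N. *)
Lemma expmx_truncB n (A B : 'M[R]_n) N : A * B = B * A ->
  expmx_trunc A N * expmx_trunc B N - expmx_trunc (A + B) N =
  \sum_(i < N) \sum_(j < N | ~~ (j + i < N)%N)
    (j`!%:R^-1 * i`!%:R^-1) *: (A ^+ j * B ^+ i).
Proof.
move=> AB; rewrite expmx_truncM expmx_truncD // -sumrB; apply: eq_bigr => i _.
by rewrite (bigID (fun j : 'I_N => (j + i < N)%N)) /= addrAC subrr add0r.
Qed.

Lemma mul_scalar_mxE n (a b : R) : (a%:M : 'M[R]_n) * b%:M = (a * b)%:M.
Proof. by rewrite scalar_mxM. Qed.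

Lemma scalar_mxX n (a : R) m : (a%:M : 'M[R]_n) ^+ m = (a ^+ m)%:M.
Proof.
elim: m => [|m IH] //; by rewrite !exprS IH mul_scalar_mxE.
Qed.

Lemma expmx_trunc_scalar n (a : R) N :
  expmx_trunc (a%:M : 'M[R]_n) N = (series (exp_coeff a) N)%:M.
Proof.
apply/matrixP => i j; rewrite expmx_truncE mxE /series /= -sumrMnl.
by apply: eq_bigr => m _; rewrite scalar_mxX mxE mulrnAl.
Qed.

Lemma expmx_scalar n (a : R) : expmx (a%:M : 'M[R]_n) = (expR a)%:M.
Proof.
apply: expmx_unique => i j; under eq_fun do rewrite expmx_trunc_scalar mxE.
rewrite mxE; case: (i == j); last exact: cvg_cst.
rewrite mulr1n; under eq_fun do rewrite mulr1n.
exact: is_cvg_series_exp_coeff.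
Qed.

(** The missing terms are dominated by those of the scalar exponentials of the
    norms, where they are known to vanish in the limit. *)
Lemma expmx_truncB_entry n (A B : 'M[R]_n) a b N i j : A * B = B * A ->
  row_bound A a -> row_bound B b ->
  `|(expmx_trunc A N * expmx_trunc B N - expmx_trunc (A + B) N) i j| <=
  series (exp_coeff a) N * series (exp_coeff b) N - series (exp_coeff (a + b)) N.
Proof.
move=> AB Aa Bb.
(* The scalar remainder is the same expression for 1 x 1 matrices. *)
have comm : (a%:M : 'M[R]_1) * b%:M = b%:M * a%:M.
  by rewrite !mul_scalar_mxE mulrC.
have := expmx_truncB N comm.
have -> : a%:M + b%:M = (a + b)%:M :> 'M[R]_1 by rewrite raddfD.
rewrite !expmx_trunc_scalar mul_scalar_mxE -raddfB.
move=> /(congr1 (fun M : 'M[R]_1 => M 0 0)).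
rewrite [LHS]mxE eqxx mulr1n => ->.
rewrite (expmx_truncB N AB) !summxE; apply: le_trans (ler_norm_sum _ _ _) _.
apply: ler_sum => k _; rewrite !summxE; apply: le_trans (ler_norm_sum _ _ _) _.
apply: ler_sum => l _; rewrite !scalar_mxX mul_scalar_mxE.
rewrite [X in `|X| <= _]mxE [leRHS]mxE [X in _ <= _ * X]mxE eqxx mulr1n.
rewrite normrM ger0_norm ?ler_wpM2l //.
apply: row_bound_entry; exact: row_boundM (row_boundX _ _) (row_boundX _ _).
Qed.

Lemma expmxD n (A B : 'M[R]_n) : A * B = B * A ->
  expmx (A + B) = expmx A * expmx B.
Proof.
move=> AB; apply: expmx_unique => i j.
set a := entry_sum A; set b := entry_sum B.
have prod : (expmx_trunc A N * expmx_trunc B N) i j @[N --> \oo] -->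
            (expmx A * expmx B) i j.
  under eq_fun do rewrite mxE; rewrite mxE; apply: cvg_sum_ord => k.
  by apply: cvgM; exact: expmx_cvg.
have gap0 : (series (exp_coeff a) N * series (exp_coeff b) N -
             series (exp_coeff (a + b)) N) @[N --> \oo] --> (0 : R).
  rewrite -(subrr (expR (a + b))) {1}expRD; apply: cvgB.
    by apply: cvgM; exact: is_cvg_series_exp_coeff.
  exact: is_cvg_series_exp_coeff.
have diff0 : (expmx_trunc A N * expmx_trunc B N - expmx_trunc (A + B) N) i j
             @[N --> \oo] --> (0 : R).
  apply: norm_cvg0; apply: squeeze_cvgr (cvg_cst 0) gap0.
  apply: nearW => N; rewrite normr_ge0 /=.
  exact: expmx_truncB_entry AB (row_bound_entry_sum A) (row_bound_entry_sum B).
rewrite -[X in _ --> X]subr0.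
rewrite (_ : (fun N => _) = (fun N => (expmx_trunc A N * expmx_trunc B N) i j)
  \- (fun N => (expmx_trunc A N * expmx_trunc B N - expmx_trunc (A + B) N) i j)).
  exact: cvgB prod diff0.
have E (M P : 'M[R]_n) : P i j = M i j - (M - P) i j by rewrite !mxE; ring.
by apply/funext => N; exact: E.
Qed.

Lemma expmx_intertwine n m (A : 'M[R]_n) (B : 'M[R]_m) (T : 'M[R]_(n, m)) :
  A *m T = T *m B -> expmx A *m T = T *m expmx B.
Proof.
move=> AB.
have X k : A ^+ k *m T = T *m B ^+ k.
  elim: k => [|k IH]; first by rewrite mul1mx mulmx1.
  rewrite !exprSr -[A ^+ k * A]/(_ *m _) -[B ^+ k * B]/(_ *m _).
  by rewrite -mulmxA AB !mulmxA IH.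
have Tr N : expmx_trunc A N *m T = T *m expmx_trunc B N.
  rewrite /expmx_trunc mulmx_suml mulmx_sumr; apply: eq_bigr => k _.
  by rewrite -scalemxAl -scalemxAr X.
apply/matrixP => i j.
have cl : (expmx_trunc A N *m T) i j @[N --> \oo] --> (expmx A *m T) i j.
  under eq_fun do rewrite mxE; rewrite mxE; apply: cvg_sum_ord => k.
  by apply: cvgM; [exact: expmx_cvg|exact: cvg_cst].
have cr : (expmx_trunc A N *m T) i j @[N --> \oo] --> (T *m expmx B) i j.
  under eq_fun do rewrite Tr mxE; rewrite mxE; apply: cvg_sum_ord => k.
  by apply: cvgM; [exact: cvg_cst|exact: expmx_cvg].
exact: cvg_unique cl cr.
Qed.

Lemma expmx_tr n (A : 'M[R]_n) : expmx A^T = (expmx A)^T.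
Proof.
apply: expmx_unique => i j; rewrite mxE.
have X k : A^T ^+ k = (A ^+ k)^T.
  elim: k => [|k IH]; first by rewrite trmx1.
  by rewrite exprS IH exprSr -[LHS]/(_ *m _) -[_ * A]/(_ *m _) trmx_mul.
have E N : expmx_trunc A^T N i j = expmx_trunc A N j i.
  by rewrite !expmx_truncE; apply: eq_bigr => k _; rewrite X mxE.
by under eq_fun do rewrite E; exact: expmx_cvg.
Qed.

Lemma expmx_nonneg n (A : 'M[R]_n) i j : (forall i j, 0 <= A i j) ->
  0 <= expmx A i j.
Proof.
move=> A0; apply: cvgr_to_ge (@expmx_cvg n A i j) _; apply: nearW => N.
rewrite summxE; apply: sumr_ge0 => k _; rewrite mxE mulr_ge0 //.
move: (k : nat) => m; elim: m i j {k} => [|m IH] i j; first by rewrite mxE.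
by rewrite exprS mxE sumr_ge0 // => l _; rewrite mulr_ge0.
Qed.

(** Adding a multiple c of the identity makes all entries nonnegative, and this
    only rescales the exponential by [expR c]. *)
Lemma expmx_offdiag_nonneg n (A : 'M[R]_n) i j :
  (forall i j, i != j -> 0 <= A i j) -> 0 <= expmx A i j.
Proof.
move=> A0; set c := entry_sum A.
have comm : (A + c%:M) * (- c)%:M = (- c)%:M * (A + c%:M).
  by rewrite -[LHS]/(_ *m _) -[RHS]/(_ *m _) scalar_mxC.
have -> : A = (A + c%:M) + (- c)%:M by rewrite raddfN addrK.
rewrite (expmxD comm) expmx_scalar -[_ * _]/(_ *m _) mul_mx_scalar mxE.
rewrite mulr_ge0 ?expR_ge0 //; apply: expmx_nonneg => k l; rewrite !mxE.
have [->|kl] := eqVneq k l; last by rewrite addr0 A0.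
have := row_bound_entry l l (row_bound_entry_sum A).
by rewrite mulr1n ler_norml => /andP[+ _]; rewrite -subr_ge0 opprK.
Qed.

End MatrixExponential.

(** * Laws and semigroups of finite Markov chains *)

Section FiniteKernel.
Variable R : realType.

Lemma sum_enum_val (S : finType) (F : S -> R) :
  \sum_(i < #|S|) F (enum_val i) = \sum_x F x.
Proof. by rewrite [RHS](reindex _ (onW_bij _ (enum_val_bij S))). Qed.

Definition kernel_mx (S T : finType) (K : S -> T -> R) : 'M[R]_(#|S|, #|T|) :=
  \matrix_(i, j) K (enum_val i) (enum_val j).

Lemma kernel_mx_inj (S T : finType) (K K' : S -> T -> R) :
  kernel_mx K = kernel_mx K' -> forall x y, K x y = K' x y.
Proof.
move=> /matrixP KK' x y; have := KK' (enum_rank x) (enum_rank y).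
by rewrite !mxE !enum_rankK.
Qed.

Lemma kernel_mxM (S T U : finType) (K : S -> T -> R) (K' : T -> U -> R) :
  kernel_mx K *m kernel_mx K' = kernel_mx (fun x z => \sum_y K x y * K' y z).
Proof.
apply/matrixP => i k; rewrite !mxE -[RHS]sum_enum_val.
by apply: eq_bigr => j _; rewrite !mxE.
Qed.

Lemma law_mx (S : finType) (q : S -> S -> R) t :
  kernel_mx (law q t) = expmx (t *: generator_mx q).
Proof. by apply/matrixP => i j; rewrite !mxE /law !enum_valK. Qed.

(** Passing to exponentials, an intertwining of generators is one of laws. *)
Lemma law_intertwine (S T : finType) (q : S -> S -> R) (q' : T -> T -> R)
    (K : S -> T -> R) :
  (forall x y, \sum_z generator q x z * K z y =
               \sum_z K x z * generator q' z y) ->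
  forall t x y, \sum_z law q t x z * K z y = \sum_z K x z * law q' t z y.
Proof.
move=> qK t; apply: kernel_mx_inj; rewrite -!kernel_mxM !law_mx.
apply: expmx_intertwine; rewrite -scalemxAl -scalemxAr; congr (_ *: _).
rewrite -[generator_mx q]/(kernel_mx (generator q)).
rewrite -[generator_mx q']/(kernel_mx (generator q')) !kernel_mxM.
by apply/matrixP => i j; rewrite !mxE qK.
Qed.

Section Semigroup.
Variables (S : finType) (q : S -> S -> R).

Lemma law_semigroup s t x y :
  law q (s + t) x y = \sum_z law q s x z * law q t z y.
Proof.
apply: (kernel_mx_inj (K := law q (s + t))
  (K' := fun x y => \sum_z law q s x z * law q t z y)).
rewrite -kernel_mxM !law_mx scalerDl expmxD //.
by rewrite -[LHS]/(_ *m _) -[RHS]/(_ *m _) -!scalemxAl -!scalemxAr !scalerA mulrC.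
Qed.

Lemma generator_sum0 x : \sum_y generator q x y = 0.
Proof.
rewrite (bigD1 x) //= /generator eqxx addrC; apply/eqP; rewrite subr_eq0; apply/eqP.
by apply: eq_bigr => y /negPf yx; rewrite eq_sym yx.
Qed.

(** Constants intertwine the chain with the trivial chain on one point. *)
Lemma law_sum1 t x : \sum_y law q t x y = 1.
Proof.
pose q0 (_ _ : unit) : R := 0.
have gen0 u v : generator q0 u v = 0.
  by rewrite /generator big1 ?oppr0 ?if_same.
have := @law_intertwine S unit q q0 (fun _ _ => 1) _ t x tt.
under eq_bigr do rewrite mulr1.
move=> ->; last first.
  move=> {}x u; under eq_bigr do rewrite mulr1; rewrite generator_sum0.
  by rewrite big1 // => v _; rewrite gen0 mulr0.
under eq_bigr do rewrite mul1r; rewrite (bigD1 tt) //= big1 ?addr0; last by case.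
apply: (kernel_mx_inj (K := law q0 t) (K' := fun u v => (u == v)%:R) _ tt tt).
rewrite law_mx (_ : _ *: _ = 0%:M) ?expmx_scalar ?expR0.
  by apply/matrixP => i j; rewrite !mxE (inj_eq enum_val_inj).
by apply/matrixP => i j; rewrite !mxE gen0 mulr0 mul0rn.
Qed.

Lemma law_ge0 t x y : (forall x y, 0 <= q x y) -> 0 <= t -> 0 <= law q t x y.
Proof.
move=> q0 t0.
have -> : law q t x y = kernel_mx (law q t) (enum_rank x) (enum_rank y).
  by rewrite mxE !enum_rankK.
rewrite law_mx; apply: expmx_offdiag_nonneg => i j /negPf ij.
by rewrite !mxE mulr_ge0 // /generator (inj_eq enum_val_inj) ij.
Qed.

Lemma law_sym t x y : (forall x y, x != y -> q x y = q y x) ->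
  law q t x y = law q t y x.
Proof.
move=> qC; apply: (kernel_mx_inj (K := law q t) (K' := fun x y => law q t y x)).
transitivity (kernel_mx (law q t))^T; last by apply/matrixP => i j; rewrite !mxE.
rewrite !law_mx -expmx_tr; congr expmx; apply/matrixP => i j; rewrite !mxE.
congr (_ * _); rewrite /generator (inj_eq enum_val_inj) [_ == enum_val i]eq_sym.
rewrite (inj_eq enum_val_inj); case: eqVneq => [->//|ij].
by rewrite qC // (inj_eq enum_val_inj).
Qed.

(** For a chain moving by random maps, the generator acts by averaging the
    increments of the observable; maps fixing [x] contribute nothing, which is why
    the rates are constrained off the diagonal only. *)
Lemma generator_jumps (I : finType) (E : {set I}) (r : I -> R) (act : I -> S -> S)
    (f : S -> R) x :
  (forall y, x != y -> q x y = \sum_(e in E | act e x == y) r e) ->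
  \sum_y generator q x y * f y = \sum_(e in E) r e * (f (act e x) - f x).
Proof.
move=> qE.
have -> : \sum_y generator q x y * f y = \sum_y generator q x y * (f y - f x).
  apply/eqP; rewrite -subr_eq0 -sumrB.
  under eq_bigr do rewrite mulrBr opprB addrC subrK.
  by rewrite -mulr_suml generator_sum0 mul0r.
rewrite (partition_big (fun e => act e x) xpredT) //=; apply: eq_bigr => y _.
have [<-|xy] := eqVneq x y.
  by rewrite subrr mulr0 big1 // => e /andP[_ /eqP ->]; rewrite subrr mulr0.
rewrite /generator (negPf xy) qE // mulr_suml.
by apply: eq_bigr => e /andP[_ /eqP ->].
Qed.

(** The difference of integrals is largest when [g] is [d] times the indicator of
    the set where [mu] exceeds [nu]. *)
Lemma sum_diff_le_tv (mu nu g : S -> R) eps d : 0 <= d ->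
  tv_dist mu nu <= eps -> (forall x, 0 <= g x <= d) ->
  \sum_x mu x * g x - \sum_x nu x * g x <= d * eps.
Proof.
move=> d0 tv g0d; pose A := [set x | nu x <= mu x]%SET.
apply: (@le_trans _ _ (d * (\sum_(x in A) mu x - \sum_(x in A) nu x))).
  rewrite -sumrB -[in leRHS]sumrB mulr_sumr [leRHS]big_mkcond /=.
  apply: ler_sum => x _; rewrite -mulrBl inE; have /andP[g0 gd] := g0d x.
  case: ifPn => [mx|]; first by rewrite mulrC ler_wpM2r // subr_ge0.
  by rewrite -ltNge => /ltW mx; rewrite mulr_le0_ge0 // subr_le0.
rewrite ler_wpM2l // (le_trans _ tv) // (le_trans (ler_norm _)) //.
by rewrite /tv_dist; apply: (le_bigmax_cond _ (fun A : {set S} =>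
  `|\sum_(x in A) mu x - \sum_(x in A) nu x|)).
Qed.

Lemma tv_distC (mu nu : S -> R) : tv_dist mu nu = tv_dist nu mu.
Proof. by apply: eq_bigr => A _; rewrite distrC. Qed.

Definition evolve t (f : S -> R) x : R := \sum_y law q t x y * f y.

Lemma evolve_semigroup s t f x : evolve (s + t) f x = evolve s (evolve t f) x.
Proof.
rewrite /evolve; under eq_bigr do rewrite law_semigroup mulr_suml.
rewrite exchange_big /=; apply: eq_bigr => z _; rewrite mulr_sumr.
by apply: eq_bigr => y _; rewrite mulrA.
Qed.

Lemma evolve_shift t f c x : evolve t (fun y => f y - c) x = evolve t f x - c.
Proof.
rewrite /evolve; under eq_bigr do rewrite mulrBr.
by rewrite sumrB -mulr_suml law_sum1 mul1r.
Qed.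

Definition osc_le (f : S -> R) d := forall x y, f x - f y <= d.

(** Both time-t laws are within 1/4 of [nu], hence within 1/2 of each other. *)
Lemma evolve_osc_half (nu : S -> R) t f d :
  (forall x, tv_dist (law q t x) nu <= 4%:R^-1) ->
  osc_le f d -> osc_le (evolve t f) (d / 2%:R).
Proof.
move=> tv fd x y.
(* Shift f by its minimum, so that its values lie in [0, d]. *)
have [m mmin] : exists m, forall z, f m <= f z.
  by exists [arg min_(z < x) f z]%O; case: arg_minP => // z _ zmin w; exact: zmin.
have d0 : 0 <= d by have := fd x x; rewrite subrr.
pose g z := f z - f m.
have g0d z : 0 <= g z <= d by rewrite subr_ge0 mmin fd.
have := sum_diff_le_tv d0 (tv x) g0d.
have : tv_dist nu (law q t y) <= 4%:R^-1 by rewrite tv_distC.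
move=> /sum_diff_le_tv - /(_ _ _ d0 g0d).
rewrite -![\sum_z law q t _ z * g z]/(evolve t g _) /g !evolve_shift; lra.
Qed.

Lemma evolve_osc_iter (nu : S -> R) t f d m :
  (forall x, tv_dist (law q t x) nu <= 4%:R^-1) ->
  osc_le f d -> osc_le (evolve (t *+ m.+1) f) (d / 2%:R ^+ m.+1).
Proof.
move=> tv; elim: m d f => [|m IH] d f fd; first exact: evolve_osc_half.
move=> x y; rewrite mulrSr !evolve_semigroup exprS invfM mulrA.
by apply: IH; exact: evolve_osc_half fd.
Qed.

End Semigroup.
End FiniteKernel.

(** * From averages over sets of fixed size to single points *)

Section Mixing.
Variables (R : realType) (V : finType).
Implicit Types (A B H : {set V}) (g : V -> R).

(** Discarding elements of least weight one by one does not lower the average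
    weight. *)
Lemma heavy_subset g B j : (j <= #|B|)%N ->
  exists A, [/\ A \subset B, #|A| = j &
    j%:R * \sum_(v in B) g v <= #|B|%:R * \sum_(v in A) g v].
Proof.
case: j => [|j].
  by exists finset.set0; rewrite finset.sub0set cards0 big_set0 mul0r mulr0.
move Em : (#|B| - j.+1)%N => m; elim: m B Em => [|m IH] B Em jB.
  have EB : #|B| = j.+1 by apply/eqP; rewrite eqn_leq jB -subn_eq0 Em.
  by exists B; rewrite EB.
have [b0 b0B] : exists b, b \in B by apply/card_gt0P; apply: leq_trans jB.
have [b bB bmin] : exists2 b, b \in B & forall v, v \in B -> g b <= g v.
  by exists [arg min_(v < b0 in B) g v]%O; case: arg_minP.
have EB := cardsD1 b B; rewrite bB add1n in EB.
have [||A [AB Aj gA]] := IH (B :\ b)%SET; first by lia.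
  by lia.
exists A; split=> //; first exact: fintype.subset_trans AB (finset.subsetDl _ _).
have bS : #|B|%:R * g b <= \sum_(v in B) g v.
  by rewrite mulr_natl -sumr_const; apply: ler_sum => v; exact: bmin.
have SB : \sum_(v in B) g v = g b + \sum_(v in (B :\ b)%SET) g v.
  by rewrite (big_setD1 b).
have c0 : 0 < #|(B :\ b)%SET|%:R :> R by rewrite ltr0n; lia.
have EBR : #|B|%:R = 1 + #|(B :\ b)%SET|%:R :> R by rewrite EB -natr1 addrC.
rewrite -(ler_pM2l c0).
have j0 : 0 <= j.+1%:R :> R by [].
move: SB bS gA c0 j0; rewrite EBR.
move: (\sum_(v in B) _) (\sum_(v in (B :\ b)%SET) _) (\sum_(v in A) _).
move: #|_|%:R (g b) j.+1%:R => c gb k SB S' SA -> bS gA c0 k0.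
have : k * (c * gb) <= k * S' by rewrite ler_wpM2l //; lra.
nra.
Qed.

Lemma subset_of_card B j : (j <= #|B|)%N -> exists2 A : {set V}, A \subset B & #|A| = j.
Proof. by move=> /(heavy_subset (fun=> 0)) [A [AB Aj _]]; exists A. Qed.

Lemma superset_of_card B j : (#|B| <= j <= #|V|)%N ->
  exists2 A : {set V}, B \subset A & #|A| = j.
Proof.
move=> /andP[Bj jn]; have BC := cardsC B.
have [|A AB Aj] := @subset_of_card (~: B)%SET (#|V| - j)%N; first by lia.
exists (~: A)%SET; first by rewrite -(finset.setCK B) finset.setCS.
by have := cardsC A; lia.
Qed.

Variable p : V -> V -> R.
Hypothesis p_ge0 : forall x y, 0 <= p x y.
Hypothesis p_sum1 : forall x, \sum_y p x y = 1.
Hypothesis p_sym : forall x y, p x y = p y x.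

Definition hit B x : R := \sum_(y in B) p x y.
Definition discrepancy A B : R :=
  \sum_(a in A) hit B a - #|A|%:R * #|B|%:R / #|V|%:R.

Lemma hit_ge0 B x : 0 <= hit B x. Proof. exact: sumr_ge0. Qed.

Lemma hitC B x : hit (~: B)%SET x = 1 - hit B x.
Proof.
rewrite -(p_sum1 x) (bigID (mem B)) /= addrAC subrr add0r.
by apply: eq_bigl => y; rewrite !inE.
Qed.

Lemma hit_le1 B x : hit B x <= 1.
Proof. by have := hit_ge0 (~: B)%SET x; rewrite hitC; lra. Qed.

Lemma sum_hit B : \sum_x hit B x = #|B|%:R.
Proof.
rewrite exchange_big /= -sum1_card natr_sum; apply: eq_bigr => y _.
by under eq_bigr do rewrite p_sym; rewrite p_sum1.
Qed.

Lemma sum_hit1 A x : \sum_(a in A) hit [set x]%SET a = hit A x.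
Proof. by apply: eq_bigr => a _; rewrite /hit big_set1 p_sym. Qed.

Hypothesis V_gt0 : (0 < #|V|)%N.
Let n0 : 0 < #|V|%:R :> R. Proof. by rewrite ltr0n. Qed.

(** By symmetry of [p], the hitting probabilities of [B] sum to [|B|] over all
    starting points, so the discrepancies of a set and its complement cancel. *)
Lemma discrepancyC A B : discrepancy (~: A)%SET B = - discrepancy A B.
Proof.
rewrite /discrepancy; have := sum_hit B; rewrite (bigID (mem A)) /=.
have -> : \sum_(i | i \notin A) hit B i = \sum_(i in (~: A)%SET) hit B i.
  by apply: eq_bigl => i; rewrite inE.
have E : #|(~: A)%SET|%:R = #|V|%:R - #|A|%:R :> R.
  by rewrite -(cardsC A) natrD addrAC subrr add0r.
move: (\sum_(i in A) _) (\sum_(i in (~: A)%SET) _) => a b ab.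
by rewrite E -ab; field; rewrite gt_eqF.
Qed.

(** The average of the sums over k-sets is [k |B| / n], so some k-set is above and
    some is below it. *)
Lemma discrepancy_osc k B d :
  (forall A A', #|A| = k -> #|A'| = k ->
     \sum_(a in A) hit B a - \sum_(a in A') hit B a <= d) ->
  forall A, #|A| = k -> `|discrepancy A B| <= d.
Proof.
move=> osc A Ak; have kn : (k <= #|[set: V]%SET|)%N by rewrite cardsT -Ak max_card.
have [A1 [_ A1k]] := heavy_subset (hit B) kn.
have [A2 [_ A2k]] := heavy_subset (fun v => - hit B v) kn.
rewrite !sumrN cardsT.
have -> : \sum_(v in [set: V]%SET) hit B v = #|B|%:R.
  by rewrite -sum_hit; apply: eq_bigl => v; rewrite inE.
rewrite !mulrN lerN2 => h2 h1.
have := osc _ _ Ak A2k; have := osc _ _ A1k Ak.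
rewrite /discrepancy Ak.
have : k%:R * #|B|%:R / #|V|%:R <= \sum_(v in A1) hit B v.
  by rewrite ler_pdivrMr // [leRHS]mulrC.
have : \sum_(v in A2) hit B v <= k%:R * #|B|%:R / #|V|%:R.
  by rewrite ler_pdivlMr // [leLHS]mulrC.
by rewrite ler_norml => ? ? ? ?; apply/andP; split; lra.
Qed.

Variable j : nat.
Hypothesis j_gt0 : (0 < j)%N.
Hypothesis disc_le : forall A B, #|A| = j ->
  `|discrepancy A B| <= (minn j #|B|)%:R / 128%:R.

Lemma disc_card A B : #|A| = j -> `|discrepancy A B| <= j%:R / 128%:R.
Proof.
move=> /(disc_le B)/le_trans; apply.
by rewrite ler_pM2r ?invr_gt0 ?ltr0n // ler_nat geq_minl.
Qed.

(** The case of a singleton target: by symmetry of [p], this controls the mass that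
    the law started from [x] gives to any j-set. *)
Lemma disc_point A x : #|A| = j ->
  `|hit A x - j%:R / #|V|%:R| <= 128%:R^-1.
Proof.
move=> Aj; have := disc_le [set x]%SET Aj.
rewrite /discrepancy sum_hit1 Aj cards1 mulr1 => /le_trans; apply.
by rewrite ler_pdivrMr ?ltr0n // mulVf ?pnatr_eq0 // (ler_nat _ _ 1) geq_minr.
Qed.

(** Two steps of [p]. *)
Definition hit2 B x : R := \sum_z p x z * hit B z.

(** The first step spreads the mass over more than [j] points, so if the second
    step were unmixed from a non-negligible part of them, a whole j-set of bad
    starting points would contradict [disc_card]. *)
Lemma hit2_sparse B x : (16 * j <= #|V|)%N ->
  hit2 B x <= #|B|%:R / #|V|%:R + 4%:R^-1.
Proof.
move=> jn; rewrite leNgt; apply/negP => far.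
set b := #|B|%:R / #|V|%:R in far.
have b0 : 0 <= b by rewrite divr_ge0.
(* As [hit B] is at most 1, its excess 1/4 over b in mean forces mass 1/8 on the
   points where the excess is at least 1/8. *)
pose H := [set z | b + 8%:R^-1 <= hit B z]%SET.
have pH : 8%:R^-1 < hit H x.
  have : hit2 B x <= hit H x + (b + 8%:R^-1); last by lra.
  have -> : b + 8%:R^-1 = \sum_z p x z * (b + 8%:R^-1).
    by rewrite -mulr_suml p_sum1 mul1r.
  rewrite [X in X + _]big_mkcond.
  rewrite -big_split /=; apply: ler_sum => z _; rewrite inE.
  have pz := p_ge0 x z; case: ifPn => [_|].
    have := mulr_ge0 pz b0; have := ler_wpM2l pz (hit_le1 B z); lra.
  by rewrite -ltNge => /ltW hz; have := ler_wpM2l pz hz; lra.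
have [Hj|jH] := leqP #|H| j.
  have [|A HA Aj] := @superset_of_card H j; first by rewrite Hj; lia.
  have HAx : hit H x <= hit A x.
    rewrite /hit [leRHS](big_setID H) /= (finset.setIidPr HA) lerDl.
    exact: sumr_ge0.
  have jn16 : j%:R / #|V|%:R <= 16%:R^-1 :> R.
    by rewrite ler_pdivrMr // mulrC ler_pdivlMr // mulrC -natrM ler_nat.
  by have := disc_point x Aj; rewrite ler_norml => /andP[_]; lra.
have [A AH Aj] := subset_of_card (ltnW jH).
have := disc_card B Aj; rewrite /discrepancy Aj -mulrA -/b ler_norml => /andP[_].
have : j%:R * (b + 8%:R^-1) <= \sum_(a in A) hit B a.
  rewrite mulr_natl -Aj -sumr_const; apply: ler_sum => a aA.
  by have := fintype.subsetP AH _ aA; rewrite inE.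
have : 0 < j%:R :> R by rewrite ltr0n.
by lra.
Qed.

(** Here every set of at least [j] points contains a j-set carrying at least 1/16
    of its signed excess; since a set and its complement have opposite excess, one
    of them is large enough. *)
Lemma hit_dense B x : (#|V| <= 16 * j)%N -> (2 * j <= #|V|)%N ->
  `|hit B x - #|B|%:R / #|V|%:R| <= 4%:R^-1.
Proof.
move=> nj jn.
have main (C : {set V}) : (j <= #|C|)%N -> `|hit C x - #|C|%:R / #|V|%:R| <= 4%:R^-1.
  move=> jC; pose g v := p x v - #|V|%:R^-1.
  have sg (D : {set V}) : \sum_(v in D) g v = hit D x - #|D|%:R / #|V|%:R.
    by rewrite sumrB sumr_const mulr_natl.
  have Cn : #|C|%:R <= 16%:R * j%:R :> R.
    by rewrite -natrM ler_nat (leq_trans (max_card _)).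
  have j0 : 0 < j%:R :> R by rewrite ltr0n.
  have C0 : 0 <= #|C|%:R :> R by [].
  have [A1 [_ A1j]] := heavy_subset g jC.
  have [A2 [_ A2j]] := heavy_subset (fun v => - g v) jC.
  rewrite !sumrN !sg A1j A2j => h2 h1.
  have := disc_point x A1j; have := disc_point x A2j.
  move: h1 h2; rewrite !ler_norml.
  move: (_ - _) (_ - _) (_ - _) => u v w h1 h2 /andP[a1 a2] /andP[a3 a4].
  have j4 : 0 < j%:R * 4%:R :> R by rewrite mulr_gt0.
  by apply/andP; split; rewrite -(ler_pM2l j0); nra.
have [|Bj] := leqP j #|B|; first exact: main.
have BC := cardsC B; have := main (~: B)%SET.
have -> : hit (~: B)%SET x - #|(~: B)%SET|%:R / #|V|%:R =
          - (hit B x - #|B|%:R / #|V|%:R).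
  by rewrite hitC -BC natrD; field; rewrite -natrD BC gt_eqF.
by rewrite normrN; apply; lia.
Qed.

Lemma hit2_le B x : (2 * j <= #|V|)%N ->
  hit2 B x <= #|B|%:R / #|V|%:R + 4%:R^-1.
Proof.
move=> jn; have [nj|nj] := leqP #|V| (16 * j)%N; last exact: hit2_sparse (ltnW nj).
have -> : #|B|%:R / #|V|%:R + 4%:R^-1 =
          \sum_z p x z * (#|B|%:R / #|V|%:R + 4%:R^-1).
  by rewrite -mulr_suml p_sum1 mul1r.
apply: ler_sum => z _.
by rewrite ler_wpM2l //; have := hit_dense B z nj jn; rewrite ler_norml; lra.
Qed.

Lemma hit2_mixed B x : (2 * j <= #|V|)%N ->
  `|hit2 B x - #|B|%:R / #|V|%:R| <= 4%:R^-1.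
Proof.
move=> jn; have := hit2_le (~: B)%SET x jn.
have -> : hit2 (~: B)%SET x = 1 - hit2 B x.
  rewrite /hit2; under eq_bigr do rewrite hitC mulrBr mulr1.
  by rewrite sumrB p_sum1.
have -> : #|(~: B)%SET|%:R / #|V|%:R = 1 - #|B|%:R / #|V|%:R :> R.
  by rewrite -(cardsC B) natrD; field; rewrite -natrD cardsC gt_eqF.
by have := hit2_le B x jn; rewrite ler_norml => ? ?; apply/andP; split; lra.
Qed.

End Mixing.

(** * Duality between the exclusion process and the random walk *)

Lemma acrossE (V : finType) (a b v : V) : a != b ->
  across [set a; b]%SET v = tperm a b v.
Proof.
move=> ab; rewrite /across !inE.
have [->|va] := eqVneq v a; rewrite /= ?tpermL.
  case: pickP => [w|/(_ b)]; last by rewrite !inE eqxx orbT eq_sym ab.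
  by rewrite !inE => /andP[/negPf ->] /= /eqP.
have [->|vb] := eqVneq v b; rewrite /= ?tpermR.
  case: pickP => [w|/(_ a)]; last by rewrite !inE eqxx ab.
  by rewrite !inE => /andP[/negPf ->]; rewrite orbF => /eqP.
by rewrite tpermD // eq_sym.
Qed.

Section Exclusion.
Variables (R : realType) (V : finType) (E : {set {set V}}) (r : {set V} -> R).
Hypothesis E_simple : simple_edges E.
Hypothesis r_ge0 : forall e, e \in E -> 0 <= r e.

Lemma acrossK e : e \in E -> involutive (across e).
Proof.
move=> /E_simple/eqP/cards2P[a [b [ab ->]]] v.
by rewrite !acrossE // tpermK.
Qed.

(** Edges away from [x] fix [x], so incidence with [x] may be dropped. *)
Lemma RW1_across x y : x != y ->
  RW1 E r x y = \sum_(e in E | across e x == y) r e.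
Proof.
move=> xy; apply: eq_bigl => e; rewrite /across; case: ifP => //= _.
by rewrite (negPf xy).
Qed.

Lemma RW1_sym x y : x != y -> RW1 E r x y = RW1 E r y x.
Proof.
move=> xy; rewrite !RW1_across // 1?eq_sym //; apply: eq_bigl => e.
case: (boolP (e \in E)) => //= eE.
by rewrite -{2}(acrossK eE x) (inj_eq (inv_inj (acrossK eE))) eq_sym.
Qed.

Lemma RW1_ge0 x y : 0 <= RW1 E r x y.
Proof. by apply: sumr_ge0 => e /andP[/r_ge0]. Qed.

Section Duality.
Variable k : nat.

(** The move of EX(k) along an edge as a map of k-subsets; the default value of
    [insubd] is reached only for sets that are not edges. *)
Definition swap (e : {set V}) (A : ksubset V k) : ksubset V k :=
  insubd A (swap_contents e (val A)).

Lemma val_swap e A : e \in E -> val (swap e A) = swap_contents e (val A).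
Proof.
move=> eE; rewrite insubdK // -topredE /=.
by rewrite card_imset ?(valP A) //; exact: inv_inj (acrossK eE).
Qed.

Definition occ (A : ksubset V k) (v : V) : R := (v \in val A)%:R.

Lemma occ_swap e A v : e \in E -> occ (swap e A) v = occ A (across e v).
Proof.
move=> eE; rewrite /occ val_swap // -{1}(acrossK eE v).
by rewrite mem_imset //; exact: inv_inj (acrossK eE).
Qed.

(** Moving the particles across an edge and then testing whether [v] is occupied is
    the same as testing the original configuration at the image of [v]; the walk
    being symmetric, this is an intertwining of generators. *)
Lemma duality t A v :
  \sum_B law (@EX R V E r k) t A B * occ B v =
  \sum_a occ A a * law (RW1 E r) t a v.
Proof.
apply: law_intertwine => {}A {}v.
rewrite (@generator_jumps _ _ _ _ E r swap); last first.
  move=> B _; apply: eq_bigl => e; case: (boolP (e \in E)) => //= eE.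
  by rewrite -val_swap // (inj_eq val_inj).
transitivity (\sum_a generator (RW1 E r) v a * occ A a).
  rewrite (@generator_jumps _ _ _ _ E r (@across V)) => [|y]; last exact: RW1_across.
  by apply: eq_bigr => e eE; rewrite occ_swap.
apply: eq_bigr => a _; rewrite mulrC; congr (_ * _).
rewrite /generator eq_sym; case: eqVneq => [->//|av].
by rewrite RW1_sym // eq_sym.
Qed.

Lemma evolve_count t A (B : {set V}) :
  evolve (@EX R V E r k) t (fun C => #|val C :&: B|%:R) A =
  \sum_(a in val A) hit (law (RW1 E r) t) B a.
Proof.
have count (C : ksubset V k) : #|val C :&: B|%:R = \sum_(v in B) occ C v.
  rewrite -sum1_card natr_sum big_mkcond [RHS]big_mkcond /=.
  apply: eq_bigr => v _; rewrite inE /occ andbC.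
  by case: (v \in B); case: (v \in val C).
rewrite /evolve; under eq_bigr do rewrite count mulr_sumr.
rewrite exchange_big /=; under eq_bigr do rewrite duality.
rewrite exchange_big [RHS]big_mkcond /=; apply: eq_bigr => a _.
rewrite -mulr_sumr /occ; case: ifP => _; first by rewrite mul1r.
by rewrite mul0r.
Qed.

(** The number of particles in [B] is at most [k] and at most [|B|]; the bound
    [n - k] comes from counting the vacant sites of [B] instead. *)
Lemma count_osc (B : {set V}) : (k <= #|V|)%N ->
  osc_le (fun C : ksubset V k => #|val C :&: B|%:R : R)
    (minn (minn k (#|V| - k)) #|B|)%:R.
Proof.
move=> kV C D; rewrite lerBlDl -natrD ler_nat.
have cC := eqP (valP C); have cD := eqP (valP D).
have iC := subset_leq_card (finset.subsetIl (val C) B).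
have iC' := subset_leq_card (finset.subsetIr (val C) B).
have iD := subset_leq_card (finset.subsetIr (~: val D)%SET B).
have iD' := subset_leq_card (finset.subsetIl (~: val D)%SET B).
have := cardsID (val D) B; have := cardsC (val D).
rewrite finset.setDE ![B :&: _]finset.setIC; lia.
Qed.

Lemma EX_mixed_RW1_mixed t : (1 <= k < #|V|)%N -> 0 <= t ->
  (forall A, tv_dist (law (@EX R V E r k) t A) (@uniform_law R _) <= 4%:R^-1) ->
  forall x, tv_dist (law (RW1 E r) (t *+ 14) x) (@uniform_law R _) <= 4%:R^-1.
Proof.
move=> /andP[k1 kV] t0 mix x; have V0 : (0 < #|V|)%N by lia.
pose p := law (RW1 E r) (t *+ 7).
have p_ge0 y z : 0 <= p y z by apply: law_ge0 RW1_ge0 _; rewrite mulrn_wge0.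
have p_sum1 y : \sum_z p y z = 1 by exact: law_sum1.
have p_sym y z : p y z = p z y by apply: law_sym => *; exact: RW1_sym.
have osc B (A A' : {set V}) : #|A| = k -> #|A'| = k ->
    \sum_(a in A) hit p B a - \sum_(a in A') hit p B a <=
    (minn (minn k (#|V| - k)) #|B|)%:R / 128%:R.
  move=> /eqP Ak /eqP A'k.
  have := evolve_osc_iter 6 mix (count_osc B (ltnW kV)) (Sub A Ak) (Sub A' A'k).
  by rewrite !evolve_count -natrX.
have disc_k (B A : {set V}) : #|A| = k -> `|discrepancy p A B| <=
    (minn (minn k (#|V| - k)) #|B|)%:R / 128%:R.
  exact: discrepancy_osc (osc B) A.
have disc_j (A B : {set V}) : #|A| = minn k (#|V| - k) -> `|discrepancy p A B| <=
    (minn (minn k (#|V| - k)) #|B|)%:R / 128%:R.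
  move=> Aj; have AC := cardsC A.
  case: (boolP (k <= #|V| - k)%N) => [kk|nk]; first by apply: disc_k; lia.
  by rewrite -normrN -discrepancyC //; apply: disc_k; lia.
apply: bigmax_le => [|B _]; first by rewrite invr_ge0.
have -> : \sum_(y in B) @uniform_law R V y = #|B|%:R / #|V|%:R.
  by rewrite sumr_const mulr_natl.
have -> : \sum_(y in B) law (RW1 E r) (t *+ 14) x y = hit2 p B x.
  under eq_bigr do rewrite (mulrnDr t 7 7) law_semigroup.
  by rewrite exchange_big; apply: eq_bigr => z _; rewrite mulr_sumr.
by apply: (hit2_mixed p_ge0 p_sum1 p_sym V0 _ disc_j); lia.
Qed.

End Duality.
End Exclusion.

Theorem proposition1p7 (R : realType) :
  exists c : R, 0 < c /\
    forall (V : finType) (E : {set {set V}}) (r : {set V} -> R),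
      simple_edges E -> connected_graph E -> (2 <= #|V|)%N ->
      (forall e, e \in E -> 0 < r e) ->
      (c%:E * tmix (RW1 E r) <=
         \big[Order.min/+oo]_(1 <= k < #|V|) tmix (@EX R V E r k))%E.
Proof.
exists 14%:R^-1; split=> [|V E r simpleE _ _ r_gt0]; first by rewrite invr_gt0.
rewrite big_nat; apply: le_bigmin => [|k kV]; first exact: leey.
apply: le_ereal_inf_tmp => _ [t [t0 mix] <-].
rewrite lee_pdivrMl // -EFinM; apply: ereal_inf_lbound.
exists (14%:R * t) => //; split=> [|x]; first by rewrite mulr_ge0.
rewrite mulr_natl.
by apply: (EX_mixed_RW1_mixed simpleE _ kV t0 mix) => e /r_gt0/ltW.
Qed.
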